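(* Let $k\geq 1$ be an integer and let $G$ be a graph with $n$ vertices. If $G$ does not contain a $C_{2k+2}$, then for every real $p\geq 2$, $$\sum_{u\in V(G)}d_G^p(u)\leq kn^p+O\left(n^{p-1/2}\right).$$ That is, for every integer $k\ge 1$ and real $p\geq 2$ there is a constant $c=c(k,p)$ such that every graph $G$ with $n\geq 1$ vertices containing no $C_{2k+2}$ satisfies $\sum_{u\in V(G)}d_G^p(u)\leq kn^p+c\,n^{p-1/2}$.
   Context: Graphs are finite, simple and undirected. $C_l$ denotes the cycle of length $l$; ''$G$ does not contain a $C_{2k+2}$'' means that $G$ has no (not necessarily induced) subgraph isomorphic to $C_{2k+2}$. $d_G(u)$ denotes the degree of the vertex $u$ in $G$, and $d_G^p(u)=(d_G(u))^p$. *)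

(* Defs.v *)
(* MathComp + MathComp-Analysis. *)
From HB Require Import structures.
From mathcomp Require Import all_boot all_order all_algebra.
From mathcomp Require Import reals exp.

Set Implicit Arguments.
Unset Strict Implicit.
Unset Printing Implicit Defensive.

Definition simple_graph (T : finType) (e : rel T) : Prop :=
  symmetric e /\ irreflexive e.

Definition degree (T : finType) (e : rel T) (u : T) : nat :=
  #|[set v | e u v]|.

(* The copy of [h] in [e] need not be induced: only edges are preserved. *)
Definition contains_subgraph (T : finType) (e : rel T)
    (S : finType) (h : rel S) : Prop :=
  exists2 f : S -> T, injective f & forall x y : S, h x y -> e (f x) (f y).

(* [ordS] is the successor modulo [l]; this is the cycle of length [l] when
   3 <= l, and is not meant to be used for smaller [l]. *)
Definition cycle_graph (l : nat) : rel 'I_l :=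
  [rel i j | (j == ordS i) || (i == ordS j)].
Arguments cycle_graph : clear implicits.

(* Main.v *)
Require Import Defs.
From HB Require Import structures.
From mathcomp Require Import all_boot all_order all_algebra.
From mathcomp Require Import reals exp.
From mathcomp Require Import zify ring lra.
Import Order.TTheory GRing.Theory Num.Theory.
Local Open Scope ring_scope.

(** Fix a vertex [u], let [A] be its neighbourhood and [B] the set of the
    remaining vertices other than [u].  A path on [2k+1] vertices that avoids
    [u] and has both ends in [A] closes up through [u] to a [C_{2k+2}].  Such a
    path can be built greedily, alternating between two vertex sets, as soon as
    all degrees between these sets are large, and sets with large mutual degrees
    exist as soon as there are many edges ([dense_core]).  Hence in a graph
    without [C_{2k+2}] there are few edges between [A] and [B]
    ([edges_nbhd_outside]) and few inside [A] ([edges_nbhd_inside]).  The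
    coefficient [k] of [n^p] in the theorem comes from the first bound: the path
    uses only [k] vertices of [B], and each of them has to see only [k+1]
    vertices of [A].  All other losses are [O(k)] per vertex of [A].

    Together, the two bounds say that the degrees of the neighbours of [u] add
    up to at most [k n + (4k+1) d(u)].  Summing over [u] counts [d(v)] once for
    each of the [d(v)] neighbours of [v], so
    [sum d^2 <= k n^2 + (4k+1) sum d] ([sum_degree_sq]).  The error term is
    controlled by the same inequality: [sum d <= n^2] gives
    [sum d^2 = O(n^2)], whence [sum d = O(n^{3/2})] by
    [2 d sqrt n <= d^2 + n].  Finally [d^p <= n^{p-2} d^2], as [d <= n]
    and [p >= 2]. *)

(** * Subgraphs of large minimum degree *)

Section EvenCycles.
Local Open Scope nat_scope.
Variables (T : finType) (e : rel T).
Hypotheses (e_sym : symmetric e) (e_irr : irreflexive e).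

Definition nbhd (u : T) : {set T} := [set v | e u v].

Lemma card_nbhdI_sum (x : T) (Y : {set T}) :
  #|nbhd x :&: Y| = \sum_(y in Y) e x y.
Proof.
rewrite -sum1_card big_mkcond [RHS]big_mkcond; apply: eq_bigr => y _.
by rewrite !inE; case: (e x y); case: (y \in Y).
Qed.

Lemma double_count (X Y : {set T}) :
  \sum_(x in X) #|nbhd x :&: Y| = \sum_(y in Y) #|nbhd y :&: X|.
Proof.
under eq_bigr do rewrite card_nbhdI_sum.
rewrite exchange_big; apply: eq_bigr => y _.
by rewrite card_nbhdI_sum; apply: eq_bigr => x _; rewrite e_sym.
Qed.

(** Delete vertices of [X] with at most [s] neighbours in [Y] and vertices of
    [Y] with at most [t] neighbours in [X] as long as there are any.  Each
    deletion lowers the left-hand side of the hypothesis by at least as much as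
    the number of edges, so the strict inequality persists and [X] cannot run
    empty. *)
Lemma dense_core (s t : nat) (X Y : {set T}) :
  s * #|X| + t * #|Y| < \sum_(x in X) #|nbhd x :&: Y| ->
  exists X' Y' : {set T}, [/\ X' \subset X, Y' \subset Y, X' != set0,
    {in X', forall x, s < #|nbhd x :&: Y'|} &
    {in Y', forall y, t < #|nbhd y :&: X'|}].
Proof.
have [m] := ubnP (#|X| + #|Y|); elim: m X Y => // m IHm X Y ltm dense.
have [/existsP[x /andP[xX xle]]|noX] :=
  boolP [exists x, (x \in X) && (#|nbhd x :&: Y| <= s)].
  have := dense; have := cardsD1 x X; rewrite xX (big_setD1 x) //= => cX dense'.
  case: (IHm (X :\ x) Y); [lia | lia |] => X' [Y'] [sX sY n0 hx hy].
  by exists X', Y'; split=> //; apply: subset_trans sX (subD1set _ _).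
have [/existsP[y /andP[yY yle]]|noY] :=
  boolP [exists y, (y \in Y) && (#|nbhd y :&: X| <= t)].
  have := dense; have := cardsD1 y Y.
  rewrite yY double_count (big_setD1 y) //= -double_count => cY dense'.
  case: (IHm X (Y :\ y)); [lia | lia |] => X' [Y'] [sX sY n0 hx hy].
  by exists X', Y'; split=> //; apply: subset_trans sY (subD1set _ _).
exists X, Y; split=> //.
- by apply: contraTneq dense => ->; rewrite big_set0.
- move=> x xX; rewrite ltnNge; apply: contra noX => xle.
  by apply/existsP; exists x; rewrite xX.
- move=> y yY; rewrite ltnNge; apply: contra noY => yle.
  by apply/existsP; exists y; rewrite yY.
Qed.

(** * Alternating paths and even cycles *)

(** The path [x_0 y_1 x_1 ... y_k x_k] is grown greedily, two vertices at a
    time.  The two roles are kept apart because the sets [X] and [Y] may be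
    disjoint or equal: [P] stands for the vertices visited in the role of [X],
    which matter for the choice of a new [y] only where they lie in [Y], and
    symmetrically for [Q].  When [X] and [Y] are disjoint, the degree conditions
    therefore reduce to at least [k] neighbours in [Y] and more than [k] in
    [X]. *)
Lemma alternating_path (k : nat) (X Y : {set T}) :
  X != set0 ->
  (forall x (P : {set T}), x \in X -> P \subset X -> #|P| <= k ->
     k <= #|(nbhd x :&: Y) :\: P|) ->
  (forall y (Q : {set T}), y \in Y -> Q \subset Y -> #|Q| <= k ->
     k < #|(nbhd y :&: X) :\: Q|) ->
  exists x s, [/\ x \in X, last x s \in X, size s = 2 * k,
                  uniq (x :: s) & path e x s] /\ {subset x :: s <= X :|: Y}.
Proof.
move=> /set0Pn[x0 x0X] degX degY.
suff grow i : i <= k -> exists x s (P Q : {set T}),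
    [/\ x \in X, last x s \in X, size s = 2 * i, uniq (x :: s) & path e x s]
    /\ [/\ P \subset X, Q \subset Y, #|P| = i.+1, #|Q| = i &
           {subset x :: s <= P :|: Q}].
  have [x [s [P [Q [H [sP sQ _ _ sPQ]]]]]] := grow k (leqnn k).
  by exists x, s; split=> // w /sPQ; apply/subsetP/setUSS.
elim: i => [_|i IHi ltik].
  exists x0, [::], [set x0], set0; split; split; rewrite ?sub0set ?cards1 ?cards0 //.
    by rewrite sub1set.
  by move=> z; rewrite !inE orbF.
have [x [s [P [Q [[xX lX sz us ps] [sP sQ cP cQ sPQ]]]]]] := IHi (ltnW ltik).
have pick_new (Z W W' : {set T}) : #|W'| < #|Z :\: W| ->
    exists2 z, z \in Z & (z \notin W) && (z \notin W').
  move=> lt; have : 0 < #|(Z :\: W) :\: W'|.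
    have := cardsID W' (Z :\: W); have := subset_leq_card (subsetIr (Z :\: W) W').
    by lia.
  by case/card_gt0P=> z; rewrite !inE => /and3P[? ? ?]; exists z => //; apply/andP.
have [|y] := pick_new (nbhd (last x s) :&: Y) P Q.
  by have := degX _ P lX sP; lia.
rewrite !inE => /andP[ey yY] /andP[yP yQ].
(* At this point [i + 1 <= k] vertices have been visited in the role of [X], and
   [y] has more than [k] neighbours in [X] outside [y |: Q]: one of these is new. *)
have [|z] := pick_new (nbhd y :&: X) (y |: Q) P.
  have := degY y (y |: Q) yY; rewrite subUset sub1set yY sQ cardsU1 yQ.
  by move=> /(_ isT); lia.
rewrite !inE negb_or => /andP[ez zX] /andP[/andP[zy zQ] zP].
have out w : w \notin P -> w \notin Q -> w \notin x :: s.
  by move=> wP wQ; apply/negP => /sPQ; rewrite inE (negPf wP) (negPf wQ).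
exists x, (rcons (rcons s y) z), (z |: P), (y |: Q); split; split=> //.
- by rewrite last_rcons.
- by rewrite !size_rcons sz mulnS.
- rewrite -!rcons_cons !rcons_uniq us out // andbT.
  by rewrite mem_rcons inE negb_or zy out.
- by rewrite !rcons_path ps last_rcons ey ez.
- by rewrite subUset sub1set zX sP.
- by rewrite subUset sub1set yY sQ.
- by rewrite cardsU1 zP cP.
- by rewrite cardsU1 yQ cQ.
- move=> w; rewrite -!rcons_cons mem_rcons in_cons mem_rcons in_cons.
  case/or3P=> [wz|wy|ws]; rewrite !inE ?wz ?wy ?orbT //.
  by have := sPQ w ws; rewrite !inE => /orP[->|->]; rewrite ?orbT.
Qed.

Lemma cycle_contains (x : T) (s : seq T) :
  cycle e (x :: s) -> uniq (x :: s) ->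
  contains_subgraph e (cycle_graph (size s).+1).
Proof.
move=> /(pathP x) cyc us.
exists (fun i : 'I_(size s).+1 => nth x (x :: s) i) => [i j /eqP|].
  by rewrite nth_uniq //= => /eqP/val_inj.
suff succ (i : 'I_(size s).+1) : e (nth x (x :: s) i) (nth x (x :: s) (ordS i)).
  by move=> i j /orP[/eqP->|/eqP->]; rewrite // e_sym.
have lti := ltn_ord i; have := cyc i; rewrite size_rcons => /(_ lti).
rewrite -rcons_cons nth_rcons lti nth_rcons /=.
have [ltis|lesi] := ltnP i (size s); first by rewrite modn_small.
(* The last vertex is followed by the first one. *)
have -> : i = size s :> nat by lia.
by rewrite modnn eqxx.
Qed.

(** An alternating path with both ends adjacent to [u] closes up through [u];
    it avoids [u] because neither [X] nor [Y] contains it. *)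
Lemma even_cycle_of_dense (k : nat) (u : T) (X Y : {set T}) :
  X \subset nbhd u -> u \notin Y -> X != set0 ->
  (forall x (P : {set T}), x \in X -> P \subset X -> #|P| <= k ->
     k <= #|(nbhd x :&: Y) :\: P|) ->
  (forall y (Q : {set T}), y \in Y -> Q \subset Y -> #|Q| <= k ->
     k < #|(nbhd y :&: X) :\: Q|) ->
  contains_subgraph e (cycle_graph (2 * k + 2)).
Proof.
move=> /subsetP sX uY X0 degX degY.
have uX : u \notin X by apply/negP => /sX; rewrite inE e_irr.
have [x [s [[xX lX sz us ps] sXY]]] := alternating_path k X Y X0 degX degY.
have -> : 2 * k + 2 = (size (x :: s)).+1 by rewrite /= sz; lia.
apply: (cycle_contains u).
  have := sX _ xX; have := sX _ lX; rewrite !inE => eul eux.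
  by rewrite /= rcons_path eux ps e_sym.
rewrite cons_uniq us andbT; apply/negP => /sXY.
by rewrite inE (negPf uX) (negPf uY).
Qed.

(** * Degrees around a vertex *)

(** The coefficient [k] of [#|Y|] is the one that survives in the final bound.
    It suffices because [X] and [Y] are disjoint: an alternating path has at
    most [k] vertices in [X] whenever a vertex of [Y] has to be extended. *)
Lemma edges_nbhd_outside (k : nat) (u : T) (Y : {set T}) :
  ~ contains_subgraph e (cycle_graph (2 * k + 2)) ->
  u \notin Y -> [disjoint nbhd u & Y] ->
  \sum_(v in nbhd u) #|nbhd v :&: Y| <= k * #|nbhd u| + k * #|Y|.
Proof.
move=> noC uY dis; rewrite leqNgt; apply/negP => /dense_core.
move=> [X' [Y' [sX sY X0 degX degY]]]; apply: noC.
have dis' : [disjoint X' & Y'] by apply: disjointWl sX (disjointWr sY dis).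
apply: (even_cycle_of_dense k u X' Y' sX _ X0) => [|x P xX sP cP|y Q yY sQ cQ].
- by apply: contra uY; apply: (subsetP sY).
- rewrite (setDidPl _) ?(ltnW (degX _ xX)) //.
  by apply: disjointWl (subsetIr _ _) _; rewrite disjoint_sym (disjointWl sP).
- rewrite (setDidPl _) ?degY //.
  by apply: disjointWl (subsetIr _ _) _; rewrite (disjointWr sQ).
Qed.

(** Inside the neighbourhood both roles are played by the same vertices, so a
    degree above [2k] is required, in order to avoid [k] vertices of the
    opposite role and still have more than [k] choices. *)
Lemma edges_nbhd_inside (k : nat) (u : T) :
  ~ contains_subgraph e (cycle_graph (2 * k + 2)) ->
  \sum_(v in nbhd u) #|nbhd v :&: nbhd u| <= 4 * k * #|nbhd u|.
Proof.
move=> noC; rewrite (_ : 4 * k = 2 * k + 2 * k); last by lia.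
rewrite mulnDl leqNgt; apply/negP => /dense_core.
move=> [X' [Y' [sX sY X0 degX degY]]]; apply: noC.
have large (Z W : {set T}) : 2 * k < #|Z| -> #|W| <= k -> k < #|Z :\: W|.
  by have := cardsID W Z; have := subset_leq_card (subsetIr Z W); lia.
apply: (even_cycle_of_dense k u X' Y' sX _ X0) => [|x P xX _ cP|y Q yY _ cQ].
- by apply/negP => /(subsetP sY); rewrite inE e_irr.
- by apply/ltnW/large => //; apply: degX.
- by apply: large => //; apply: degY.
Qed.

(** An edge at a neighbour [v] of [u] leads to [u], to another neighbour of [u],
    or elsewhere; the three contributions are at most [d(u)], [4k d(u)] and
    [k d(u) + k (n - d(u))]. *)
Lemma sum_degree_nbhd (k : nat) (u : T) :
  ~ contains_subgraph e (cycle_graph (2 * k + 2)) ->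
  \sum_(v in nbhd u) degree e v <= k * #|T| + (4 * k + 1) * degree e u.
Proof.
move=> noC; set A := nbhd u; set B := ~: (u |: A).
have split_deg v : degree e v <= 1 + #|nbhd v :&: A| + #|nbhd v :&: B|.
  rewrite /degree -/(nbhd v) -(cardsID (u |: A) (nbhd v)) setDE leq_add2r setIUr.
  apply: leq_trans (leq_card_setU _ _).1 _; rewrite leq_add2r.
  by apply: leq_trans (subset_leq_card (subsetIr _ _)) _; rewrite cards1.
have := leq_sum (index_enum T) (P := mem A) (fun v _ => split_deg v).
rewrite !big_split /= sum1_card.
have := edges_nbhd_inside k u noC; rewrite -/A.
have -> : degree e u = #|A| by [].
have uB : u \notin B by rewrite !inE eqxx.
have dis : [disjoint A & B].
  by rewrite disjoints_subset setCK subsetUr.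
have := edges_nbhd_outside k u B noC uB dis; rewrite -/A.
have : k * #|A| + k * #|B| <= k * #|T|.
  rewrite -mulnDr -(cardsC (u |: A)) leq_mul // leq_add2r.
  by rewrite subset_leq_card ?subsetUr.
move=> cAB outB inA /leq_trans; apply.
apply: leq_trans (leq_add (leq_add (leqnn _) inA) outB) _.
by move: cAB; move: #|A| #|B| #|T| => a b n; lia.
Qed.

(** Sum the previous bound over [u]; each [degree e v] occurs on the left once
    for every neighbour [u] of [v]. *)
Lemma sum_degree_sq (k : nat) :
  ~ contains_subgraph e (cycle_graph (2 * k + 2)) ->
  \sum_u degree e u ^ 2
    <= k * #|T| ^ 2 + (4 * k + 1) * \sum_u degree e u.
Proof.
move=> noC; have <- : \sum_u \sum_(v in nbhd u) degree e v
                    = \sum_u degree e u ^ 2.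
  rewrite (exchange_big_dep predT) //=; apply: eq_bigr => v _.
  rewrite sum_nat_const -mulnn /degree; congr (_ * _).
  by apply: eq_card => u; rewrite -[LHS]/(v \in nbhd u) !inE e_sym.
rewrite -mulnn mulnCA -sum_nat_const big_distrr -big_split /=.
by apply: leq_sum => u _; apply: sum_degree_nbhd.
Qed.

End EvenCycles.

(** * Powers of degrees *)

Lemma degree_le_card (T : finType) (e : rel T) (u : T) : (degree e u <= #|T|)%N.
Proof. exact: max_card. Qed.

Theorem corollary3 (R : realType) (k : nat) (p : R) :
  (1 <= k)%N -> 2 <= p ->
  exists c : R, forall (n : nat) (T : finType) (e : rel T),
    (1 <= n)%N -> #|T| = n -> simple_graph e ->
    ~ contains_subgraph e (cycle_graph (2 * k + 2)) ->
    \sum_(u : T) (degree e u)%:R `^ p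
      <= k%:R * n%:R `^ p + c * n%:R `^ (p - 1 / 2).
Proof.
move=> _ p2; exists ((4 * k + 1)%:R * (5 * k + 2)%:R).
move=> n T e n1 cT [e_sym e_irr] noC.
have S2le := sum_degree_sq T e e_sym e_irr k noC; rewrite cT in S2le.
have degn u : (degree e u <= n)%N by rewrite -cT degree_le_card.
pose D : R := \sum_u (degree e u)%:R.
pose S2 : R := \sum_u (degree e u)%:R ^+ 2.
have n0 : 0 < n%:R :> R by rewrite ltr0n.
(* Everything is expressed in the powers of [s = sqrt n], with [n^p = q s^4] and
   [n^(p - 1/2) = q s^3]. *)
have nD (a b : R) : n%:R `^ (a + b) = n%:R `^ a * n%:R `^ b.
  by rewrite powRD // (gt_eqF n0) implybT.
pose s : R := n%:R `^ (1 / 2).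
have s0 : 0 < s by apply: powR_gt0.
have ss : n%:R = s ^+ 2 :> R.
  by rewrite expr2 -nD -splitr; apply/esym/powRr1/ltW.
pose q : R := n%:R `^ (p - 2).
have q0 : 0 <= q by apply: powR_ge0.
have np : n%:R `^ p = q * s ^+ 4.
  rewrite -[4%N]/(2 * 2)%N exprM -ss -powR_mulrn ?ltW// -nD.
  by congr (_ `^ _); ring.
have nph : n%:R `^ (p - 1 / 2) = q * s ^+ 3.
  rewrite exprSr -ss -[X in q * (X * s)]powRr1 ?ltW// -!nD.
  by congr (_ `^ _); field.
have S2D : S2 <= k%:R * s ^+ 4 + (4 * k + 1)%:R * D.
  have := S2le; rewrite -(ler_nat R) natrD 2!natrM natrX !natr_sum ss -exprM.
  by under eq_bigr do rewrite natrX.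
have Dn : D <= s ^+ 4.
  rewrite -[4%N]/(2 * 2)%N exprM -ss -natrX /D -natr_sum ler_nat -mulnn -{1}cT.
  by rewrite -sum_nat_const leq_sum.
(* The bound on the number of edges: this is [0 <= (d - s)^2] summed over the
   vertices. *)
have sD : 2 * s * D <= S2 + s ^+ 4.
  have -> : s ^+ 4 = \sum_(u : T) s ^+ 2.
    by rewrite sumr_const cT -mulr_natr ss; ring.
  rewrite /D /S2 mulr_sumr -big_split /=; apply: ler_sum => u _.
  have := sqr_ge0 ((degree e u)%:R - s); lra.
have Ds : D <= (5 * k + 2)%:R * s ^+ 3.
  rewrite -(ler_pM2l s0).
  have -> : s * ((5 * k + 2)%:R * s ^+ 3) = (5 * k + 2)%:R * s ^+ 4 by ring.
  have s4 : 0 <= (5 * k + 2)%:R * s ^+ 4 by rewrite mulr_ge0 // exprn_ge0 // ltW.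
  have kD : (4 * k + 1)%:R * D <= (4 * k + 1)%:R * s ^+ 4 by rewrite ler_wpM2l.
  suff : 2 * s * D <= (5 * k + 2)%:R * s ^+ 4 by lra.
  apply: le_trans sD _; apply: le_trans (lerD (le_trans S2D (lerD (lexx _) kD)) (lexx _)) _.
  by rewrite !(natrD _ (_ * k)%N) !natrM; lra.
have pow2 u : (degree e u)%:R `^ p <= q * (degree e u)%:R ^+ 2.
  have [->|d0] := posnP (degree e u).
    by rewrite powR0 ?expr0n ?mulr0 // gt_eqF //; lra.
  rewrite -{1}(subrK 2 p) powRD; last by rewrite pnatr_eq0 -lt0n d0 implybT.
  rewrite -powR_mulrn ?ler0n// ler_wpM2r ?powR_ge0//.
  by apply: ge0_ler_powR; rewrite ?nnegrE ?ler0n ?ler_nat ?subr_ge0.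
apply: (le_trans (ler_sum _ (fun u _ => pow2 u))).
rewrite -mulr_sumr -/S2 np nph.
rewrite [leRHS](_ : _ = q * (k%:R * s ^+ 4
   + (4 * k + 1)%:R * ((5 * k + 2)%:R * s ^+ 3))); last by ring.
apply: ler_wpM2l => //; apply: le_trans S2D _.
by rewrite lerD2l ler_wpM2l.
Qed.
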